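(* For $\pi\in S_{D+1}$, define $T(\pi)$ by $$A_{\pi^{-1}}^*\big(w_\mu(\xi)\big) = \sum_{\nu\in\mathcal{B}(\Delta_\lambda, r)} T(\pi)_{\mu\nu}\, w_\nu(\lambda), \qquad \mu\in\mathcal{B}(\Delta_\xi, r).$$ Then $T(\pi)$ is well defined, its entries lie in $\{-1,0,+1\}$, each row carries a single non-zero entry, equal to $+1$, or at most $D$ non-zero entries, all equal to $-1$, and $T(\pi)^{-1} = T(\pi^{-1})$. The matrix $T(\pi)$ depends on $r$, but only through its index set $\mathcal{B}(\Delta_\xi, r)$.
   Context: $D \ge 1$ and $r \ge 1$ are integers and $\Delta = [v_0,\dots,v_D]\subset\mathbb{R}^D$ is a non-degenerate $D$-simplex with vertex labels $0,\dots,D$, naturally ordered. Its barycentric coordinates $\xi = (\xi_0,\dots,\xi_D)$ are the affine functions with $\xi_i(v_j) = \delta_{ij}$. A face is identified with its label set $f\subseteq\{0,\dots,D\}$; $\dim f = |f|-1$, $\min f$ is the smallest label, $f\setminus k$ means $f\setminus\{k\}$. For $\alpha\in\mathbb{N}_0^{D+1}$, $|\alpha| = \sum_i\alpha_i$, $\operatorname{supp}(\alpha) = \{i:\alpha_i>0\}$, $\mathbf{1}_\alpha\in\{0,1\}^{D+1}$ has $(\mathbf{1}_\alpha)_i = 1$ iff $\alpha_i>0$, and $b(\xi;\alpha) = \prod_i\xi_i^{\alpha_i}$. For a face $f$ with $\dim f\ge1$, $k\in f$, $s\in\{0,1\}^{D+1}$ with $\operatorname{supp}(s)\cup\{k\}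 = f$, set $\psi(\xi;f,k,s) = \mathrm{d}\xi_k - \frac{s_k}{|s|}\sum_{j\in f}\mathrm{d}\xi_j$; it is anchored if $s_i = 0$ for all $i<\min(f\setminus k)$. $\mathcal{B}(\Delta_\xi, r)$ is the set of triplets $\mu = (f,k,\alpha)$ with $\dim f\ge1$, $k\in f$, $|\alpha| = r$, $\operatorname{supp}(\alpha)\cup\{k\} = f$ and $\psi(\xi;f,k,\mathbf{1}_\alpha)$ anchored; $w_\mu(\xi) = w(\xi;f,k,\alpha) = b(\xi;\alpha)\,\psi(\xi;f,k,\mathbf{1}_\alpha)$. $S_{D+1}$ is the group of bijections of $\{0,\dots,D\}$. $\Delta_\xi$ and $\Delta_\lambda$ are two copies of $\Delta$ with barycentric coordinates denoted $\xi$ and $\lambda$; all definitions are also used on $\Delta_\lambda$ with $\lambda$ in place of $\xi$. As index sets, $\mathcal{B}(\Delta_\xi, r)$ and $\mathcal{B}(\Delta_\lambda, r)$ are the same set of triplets, so $T(\pi)$ is a square matrix indexed by this set and products of such matrices make sense. $A_\pi:\Delta_\xi\to\Delta_\lambda$ is the affine map with $A_\pi(v_i) = v_{\pi(i)}$; the pullback $A_{\pi^{-1}}^*$ takes forms on $\Delta_\xi$ to forms on $\Delta_\lambda$ and is the substitution $\xi_i\mapsto\lambda_{\pi(i)}$, $\mathrm{d}\xi_i\mapsto\mathrm{d}\lambda_{\pi(i)}$. ''Depends on $r$ only through its index set'' means that the rule giving the entry $T(\pi)_{\mu\nu}$ from the triplets $\mu,\nu$ and $\pi$ is the same for all $r$.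 *)

(* Defs.v *)
From HB Require Import structures.
From mathcomp Require Import all_boot all_order all_algebra all_fingroup.
From mathcomp Require Import boolp classical_sets reals.
From mathcomp Require Import topology normedtype derive.

Set Implicit Arguments.
Unset Strict Implicit.
Unset Printing Implicit Defensive.

Import Order.TTheory GRing.Theory Num.Theory.
Import numFieldNormedType.Exports.

Local Open Scope ring_scope.

Section Combinatorics.
Variable D : nat.

Definition multiindex := {ffun 'I_D.+1 -> nat}.

Definition mdegree (a : multiindex) : nat := (\sum_i a i)%N.

Definition msupp (a : multiindex) : {set 'I_D.+1} :=
  finset (fun i => (0 < a i)%N).

Definition mind (a : multiindex) : multiindex := [ffun i => (0 < a i : nat)].

Definition face_dim (f : {set 'I_D.+1}) : nat := #|f|.-1.

(* The neutral element ord_max is the largest label, so this is the smallest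
   label of f as soon as f is nonempty. *)
Definition face_min (f : {set 'I_D.+1}) : 'I_D.+1 :=
  \big[Order.min/ord_max]_(i in f) i.

Definition anchored (f : {set 'I_D.+1}) (k : 'I_D.+1) (s : multiindex) : bool :=
  [forall i : 'I_D.+1, (i < face_min (f :\ k))%N ==> (s i == 0%N)].

Record triplet := Triplet {
  tface : {set 'I_D.+1};
  tvert : 'I_D.+1;
  tmult : multiindex
}.

Definition in_B (r : nat) (t : triplet) : bool :=
  let: Triplet f k a := t in
  [&& (1 <= face_dim f)%N, k \in f, mdegree a == r,
      msupp a :|: [set k]%SET == f & anchored f k (mind a)].

(* |alpha| = r forces alpha_i <= r, so drawing the alpha_i from 'I_r.+1 loses
   no triplet of degree r and makes the index set a finType. *)
Definition bounded_triplet (r : nat) : Type :=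
  ({set 'I_D.+1} * 'I_D.+1 * {ffun 'I_D.+1 -> 'I_r.+1})%type.

Definition triplet_of_bounded (r : nat) (t : bounded_triplet r) : triplet :=
  Triplet t.1.1 t.1.2 [ffun i => nat_of_ord (t.2 i)].

(* The index set B(Delta, r). *)
Definition Bindex (r : nat) : finType :=
  {t : bounded_triplet r | in_B r (triplet_of_bounded t)}.

Definition triplet_of (r : nat) (mu : Bindex r) : triplet :=
  triplet_of_bounded (val mu).

Definition entry (R : Type) (r : nat) (T : 'M[R]_#|Bindex r|) (mu nu : Bindex r)
  : R := T (enum_rank mu) (enum_rank nu).

(* b is the exponent of the monomial obtained from xi^a by substituting
   xi_i |-> lambda_(pi i). *)
Definition carries (pi : 'S_D.+1) (a b : multiindex) : bool :=
  [forall i, b (pi i) == a i].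

Definition same_shape (t u : triplet) : Prop :=
  [/\ tface t = tface u, tvert t = tvert u & msupp (tmult t) = msupp (tmult u)].

(* A degree-r triplet determines r (r = |alpha|), so a rule reading the full
   triplets could still branch on r.  This forbids it: apart from the faces,
   the vertices and the supports, the rule may only test whether pi carries
   one multi-index to the other. *)
Definition degree_blind (R : Type) (rule : 'S_D.+1 -> triplet -> triplet -> R)
  : Prop :=
  forall (pi : 'S_D.+1) (t u t' u' : triplet),
    same_shape t t' -> same_shape u u' ->
    carries pi (tmult t) (tmult u) = carries pi (tmult t') (tmult u') ->
    rule pi t u = rule pi t' u'.

End Combinatorics.

Section Geometry.
Variables (R : realType) (D : nat).

Definition affine_map (V : lmodType R) (F : 'rV[R]_D -> V) : Prop :=
  exists (L : {linear 'rV[R]_D -> V}) (c : V), forall x, F x = L x + c.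

Definition nondegenerate_simplex (v : 'I_D.+1 -> 'rV[R]_D) : Prop :=
  row_free (\matrix_(i < D) (v (lift ord0 i) - v ord0)).

Definition in_simplex (v : 'I_D.+1 -> 'rV[R]_D) (x : 'rV[R]_D) : Prop :=
  exists t : 'I_D.+1 -> R,
    [/\ forall i, 0 <= t i, \sum_i t i = 1 & x = \sum_i t i *: v i].

Definition barycentric (v : 'I_D.+1 -> 'rV[R]_D)
    (xi : 'I_D.+1 -> 'rV[R]_D -> R) : Prop :=
  (forall i, affine_map (xi i : 'rV[R]_D -> R^o)) /\
  (forall i j, xi i (v j) = (i == j)%:R).

Definition vertex_map (v : 'I_D.+1 -> 'rV[R]_D) (pi : 'S_D.+1)
    (F : 'rV[R]_D -> 'rV[R]_D) : Prop :=
  affine_map F /\ (forall i, F (v i) = v (pi i)).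

(* omega x h: the value of the 1-form omega at the point x on the tangent
   vector h. *)
Definition form1 := 'rV[R]_D -> 'rV[R]_D -> R.

Definition pullback (F : 'rV[R]_D -> 'rV[R]_D) (omega : form1) : form1 :=
  fun x h => omega (F x) ('d F x h).

Variable xi : 'I_D.+1 -> 'rV[R]_D -> R.

Definition bern (a : multiindex D) (x : 'rV[R]_D) : R :=
  \prod_i xi i x ^+ a i.

Definition psi (f : {set 'I_D.+1}) (k : 'I_D.+1) (s : multiindex D) : form1 :=
  fun x h => 'd (xi k) x h
    - (s k)%:R / (mdegree s)%:R * \sum_(j in f) 'd (xi j) x h.

Definition wform (t : triplet D) : form1 :=
  fun x h => bern (tmult t) x * psi (tface t) (tvert t) (mind (tmult t)) x h.

(* A is the vertex map of pi^-1, so that the pullback along A substitutes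
   lambda_(pi i) for xi_i.  Delta_xi and Delta_lambda are the same simplex with
   the same coordinate functions xi.  Forms are compared at the points of the
   simplex only. *)
Definition transition (v : 'I_D.+1 -> 'rV[R]_D) (A : 'rV[R]_D -> 'rV[R]_D)
    (r : nat) (T : 'M[R]_#|Bindex D r|) : Prop :=
  forall (mu : Bindex D r) (x h : 'rV[R]_D), in_simplex v x ->
    pullback A (wform (triplet_of mu)) x h =
    \sum_(nu : Bindex D r) entry T mu nu * wform (triplet_of nu) x h.

End Geometry.

(* Main.v *)
(** The anchored triplets with multi-index a, supported on S, are exactly the
    pairs (a, k) where k is not the smallest element of S.  Modulo
    sum_i d xi_i = 0 the corresponding psi's are linearly independent (dual
    vectors are explicit), and monomials in barycentric coordinates are
    independent on the simplex, by homogeneity and the Kronecker substitution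
    xi_i = t^((r+1)^i); hence T(pi) is unique.  Substituting along pi turns
    (a, k) into (pi a, pi k): either this is again anchored, giving a single
    entry +1, or pi k is the smallest element of pi S, and since the psi's over
    pi S sum to zero, its psi is minus the sum of the other ones. *)

Require Import Defs.
From mathcomp Require Import all_boot all_order all_algebra all_fingroup.
From mathcomp Require Import boolp classical_sets functions reals.
From mathcomp Require Import topology normedtype derive.

Set Implicit Arguments.
Unset Strict Implicit.
Unset Printing Implicit Defensive.

Import Order.TTheory GRing.Theory Num.Theory.
Import numFieldNormedType.Exports.

Local Open Scope ring_scope.

(** * Anchored triplets *)

(** As a predicate it is false for every k outside S, so such vertices count as non-lowest, as
    anchoring requires. *)
Definition lowest (n : nat) (S : {set 'I_n}) (k : 'I_n) : bool :=
  (k \in S) && [forall j in S, (k <= j)%N].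

Lemma lowest_uniq n (S : {set 'I_n}) k l : lowest S k -> lowest S l -> k = l.
Proof.
move=> /andP[kS /forall_inP lek] /andP[lS /forall_inP lel].
by apply/val_inj/eqP; rewrite eqn_leq lek ?lel.
Qed.

Lemma lowest_ex n (S : {set 'I_n}) i : i \in S -> exists k, lowest S k.
Proof.
move=> iS; case: (arg_minnP (fun j : 'I_n => val j) iS) => k kS lek.
exists k; apply/andP; split; [exact: kS | exact/forall_inP].
Qed.

Lemma face_min_le D (f : {set 'I_D.+1}) i : i \in f -> (face_min f <= i)%N.
Proof. exact: (@bigmin_le_cond _ _ _ ord_max _ (mem f) id). Qed.

Lemma lt_face_min D (f : {set 'I_D.+1}) (i : 'I_D.+1) :
  (0 < #|f|)%N -> (forall j, j \in f -> (i < j)%N) -> (i < face_min f)%N.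
Proof.
case/card_gt0P=> j jf lti; rewrite /face_min; elim/big_ind: _ => //.
  exact: leq_trans (lti j jf) (leq_ord j).
by move=> x y ix iy; rewrite minElt; case: ifP.
Qed.

Lemma mdegree_mind D (a : multiindex D) : mdegree (mind a) = #|msupp a|.
Proof.
rewrite -sum1_card big_mkcond /=; apply: eq_bigr => i _.
by rewrite ffunE inE; case: (0 < a i)%N.
Qed.

Lemma card_msupp_gt0 D (a : multiindex D) :
  (0 < mdegree a)%N -> (0 < #|msupp a|)%N.
Proof.
rewrite lt0n sum_nat_eq0 negb_forall => /existsP[i]; rewrite -lt0n => ai.
by apply/card_gt0P; exists i; rewrite inE.
Qed.

(** Let S = [msupp a], nonempty because r > 0. If S \ k is nonempty, k is the only label of S that
    can lie below the minimum of f \ k = S \ k, so anchoring fails exactly when k is lowest in S.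
    The case S = {k}, where k is lowest too, is ruled out by the dimension. *)
Lemma in_B_lowest D r f k (a : multiindex D) : (0 < r)%N ->
  in_B r (Triplet f k a) =
  [&& mdegree a == r, f == msupp a :|: [set k] & ~~ lowest (msupp a) k].
Proof.
move=> r0; rewrite /in_B [_ :|: _ == f]eq_sym.
have [ar|] := eqVneq (mdegree a) r; last by rewrite !andbF.
have [->|] := eqVneq f (msupp a :|: [set k]); last by rewrite /= !andbF.
rewrite finset.in_setU finset.in_set1 eqxx orbT /=.
have /card_gt0P[i iS] : (0 < #|msupp a|)%N by rewrite card_msupp_gt0 ?ar.
apply/andP/idP => [[dim2 anch]|nlow].
  apply/negP => /andP[kS /forall_inP lek].
  move/forallP: anch => /(_ k); rewrite ffunE; move: (kS).
  rewrite inE => ->; apply/negP; rewrite negb_imply andbT.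
  apply: lt_face_min => [|j].
    move: dim2; rewrite /face_dim.
    by rewrite (cardsD1 k) !inE eqxx orbT.
  rewrite finset.in_setD1 finset.in_setU finset.in_set1; case: eqVneq => //= njk.
  rewrite orbF => jS.
  by rewrite ltn_neqAle lek // andbT eq_sym.
split.
  rewrite /face_dim; have [kS|kS] := boolP (k \in msupp a).
    move: nlow; rewrite /lowest kS /= negb_forall => /existsP[j].
    rewrite negb_imply => /andP[jS jk].
    have njk : j != k by apply: contraNneq jk => ->.
    by rewrite (cardsD1 k) (cardsD1 j) !inE eqxx njk orbT; move: jS; rewrite inE => ->.
  have nik : i != k by apply: contraNneq kS => <-.
  by rewrite (cardsD1 k) (cardsD1 i) !inE eqxx nik orbT; move: iS; rewrite inE => ->.
apply/forallP => j; apply/implyP => ltj; rewrite ffunE.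
case: posnP => // aj; have jS : j \in msupp a by rewrite inE.
have [jk|jk] := eqVneq j k; last first.
  by move: ltj; rewrite ltnNge face_min_le // finset.in_setD1 jk finset.in_setU jS.
move: jS ltj; rewrite jk => kS ltk; case/negP: nlow; rewrite /lowest kS.
apply/forall_inP => j' j'S; have [->//|j'k] := eqVneq j' k.
apply: ltnW; apply: leq_trans ltk _; apply: face_min_le.
by rewrite finset.in_setD1 j'k finset.in_setU j'S.
Qed.

(** * The constant forms psi on a fixed support *)

Section SetForms.
Variables (R : numFieldType) (n : nat).
Implicit Types (S : {set 'I_n}) (k l : 'I_n) (H : 'I_n -> R).

(** [psi] sums over f = S ∪ {k} instead of S; the two sums differ only for k outside S, where the
    coefficient vanishes. *)
Definition psi_val S k H : R :=
  H k - (k \in S)%:R / #|S|%:R * \sum_(j in S) H j.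

(** For k in S the value is the deviation of [H k] from the mean of H over S. *)
Lemma sum_psi_val S H : \sum_(k in S) psi_val S k H = 0.
Proof.
have [S0|S0] := posnP #|S|.
  by rewrite big_pred0 // => j; rewrite (card0_eq S0).
have -> : \sum_(k in S) psi_val S k H =
    \sum_(k in S) H k - \sum_(k in S) 1 / #|S|%:R * \sum_(j in S) H j.
  by rewrite -sumrB; apply: eq_bigr => k kS; rewrite /psi_val kS.
by rewrite -!mulr_suml sumr_const divff ?mul1r ?subrr // pnatr_eq0 -lt0n.
Qed.

(* Since the psi's over S sum to zero, the one at the lowest vertex is minus
   the sum of the others. *)
Lemma psi_val_expand S k H :
  psi_val S k H = \sum_(l | ~~ lowest S l)
    (if lowest S k then - (l \in S)%:R else (l == k)%:R) * psi_val S l H.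
Proof.
have [lowk|lowk] := boolP (lowest S k); last first.
  rewrite (bigD1 k) /= ?lowk // eqxx mul1r big1 ?addr0 // => l /andP[_ /negbTE->].
  by rewrite mul0r.
have kS : k \in S by case/andP: lowk.
have := sum_psi_val S H; rewrite (bigD1 k) //= => /eqP; rewrite addr_eq0 => /eqP->.
rewrite -sumrN [LHS]big_mkcond [RHS]big_mkcond; apply: eq_bigr => l _ /=.
have [lS|lS] := boolP (l \in S); last by rewrite /= oppr0 mul0r if_same.
have -> : lowest S l = (l == k).
  by apply/idP/eqP => [lowl|->//]; apply: lowest_uniq lowl lowk.
by rewrite /= mulN1r.
Qed.

(* The family of vectors dual to the psi_val S k, k not lowest in S. *)
Definition dual_vec S l : 'I_n -> R :=
  fun i => (i == l)%:R -
    (if l \in S then (lowest S i)%:R else (i \in S)%:R / #|S|%:R).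

(** A general P serves both the sum over all labels and the sum over S. *)
Lemma sum_lowest S (P : pred 'I_n) : (0 < #|S|)%N -> {subset S <= P} ->
  \sum_(i | P i) (lowest S i)%:R = 1 :> R.
Proof.
case/card_gt0P => i /lowest_ex[m lowm] SP.
have Pm : P m by case/andP: lowm => /SP.
rewrite (bigD1 m) //= lowm big1 ?addr0 // => j /andP[_].
by case: (boolP (lowest S j)) => // /lowest_uniq/(_ lowm)->; rewrite eqxx.
Qed.

Lemma sum_uniform S (P : pred 'I_n) : (0 < #|S|)%N -> {subset S <= P} ->
  \sum_(i | P i) (i \in S)%:R / #|S|%:R = 1 :> R.
Proof.
move=> S0 SP; rewrite -mulr_suml.
have -> : \sum_(i | P i) (i \in S)%:R = #|S|%:R :> R.
  rewrite -sum1_card natr_sum big_mkcond [RHS]big_mkcond; apply: eq_bigr => i _.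
  by have [/SP|_] := boolP (i \in S); [rewrite unfold_in => -> | rewrite if_same].
by rewrite divff // pnatr_eq0 -lt0n.
Qed.

(** Compatibility with sum_i d xi_i = 0: the dual vectors are tangent vectors. *)
Lemma sum_dual_vec S l : (0 < #|S|)%N -> \sum_i dual_vec S l i = 0.
Proof.
move=> S0; rewrite sumrB (bigD1 l) //= eqxx big1 ?addr0; last first.
  by move=> i /negbTE->.
by case: (boolP (l \in S)) => _; rewrite ?sum_lowest ?sum_uniform ?subrr.
Qed.

(** For l in S the vector is e_l - e_m with m lowest: its sum over S is 0, and k differs from m. For
    l outside S, the uniform weight on S is subtracted from e_l: the sum over S is -1, and the two
    terms in 1/|S| cancel. *)
Lemma psi_dual_vec S k l : (0 < #|S|)%N -> ~~ lowest S k ->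
  psi_val S k (dual_vec S l) = (k == l)%:R.
Proof.
move=> S0 nlow; rewrite /psi_val sumrB /dual_vec (negbTE nlow).
have [lS|lS] := boolP (l \in S).
  rewrite (bigD1 l) //= eqxx big1 ?addr0 => [|i /andP[_ /negbTE->]//].
  by rewrite sum_lowest // subrr mulr0 !subr0.
rewrite big1 => [|i iS]; last by have [il|//] := eqVneq i l; rewrite -il iS in lS.
by rewrite sum_uniform // sub0r mulrN1 opprK subrK.
Qed.

End SetForms.

(** * Kronecker substitution *)

(** Uniqueness of base-b digits: the remainder mod b gives the lowest digit, the quotient the
    others. *)
Lemma kronecker_inj b n (a c : 'I_n -> nat) :
  (forall i, a i < b)%N -> (forall i, c i < b)%N ->
  (\sum_i a i * b ^ i = \sum_i c i * b ^ i)%N -> a =1 c.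
Proof.
elim: n a c => [|n IHn] a c ab cb; first by move=> _ [].
have split d : (\sum_(i < n.+1) d i * b ^ i =
    (\sum_(i < n) d (lift ord0 i) * b ^ i) * b + d ord0)%N.
  rewrite big_ord_recl expn0 muln1 addnC big_distrl; congr (_ + _)%N.
  by apply: eq_bigr => i _; rewrite expnSr mulnA.
have b0 : (0 < b)%N by apply: leq_ltn_trans (ab ord0).
rewrite !split => eqs.
have eq0 : a ord0 = c ord0.
  by have := congr1 (modn^~ b) eqs; rewrite /= !modnMDl !modn_small.
have eqS : forall i, a (lift ord0 i) = c (lift ord0 i).
  apply: (IHn (a \o lift ord0) (c \o lift ord0)) => [i|i|]; rewrite /= ?ab ?cb //.
  by have := congr1 (divn^~ b) eqs; rewrite /= !divnMDl ?divn_small ?addn0.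
by move=> i; case: (unliftP ord0 i) => [j|] ->.
Qed.

Lemma poly_pos_eq0 (R : numDomainType) (p : {poly R}) :
  (forall t, 0 < t -> p.[t] = 0) -> p = 0.
Proof.
move=> p0; apply/eqP; apply: contraT => pn0.
(* The points 1, ..., [size p] are one root more than the degree allows. *)
pose rs := [seq i.+1%:R : R | i <- iota 0 (size p)].
have /(max_poly_roots pn0) : all (root p) rs.
  by apply/allP => _ /mapP[i _ ->]; apply/rootP/p0; rewrite ltr0n.
have -> : uniq rs.
  rewrite map_inj_uniq ?iota_uniq // => i j /eqP.
  by rewrite eqr_nat eqSS => /eqP.
by rewrite size_map size_iota ltnn => /(_ isT).
Qed.

(** * The index set *)

(** The inverse makes the value at [pi i] equal to [a i], as the substitution xi_i -> lambda_(pi i)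
    demands. *)
Definition permute D (pi : 'S_D.+1) (a : multiindex D) : multiindex D :=
  [ffun i => a ((pi^-1)%g i)].

Lemma carriesE D (pi : 'S_D.+1) (a b : multiindex D) :
  carries pi a b = (b == permute pi a).
Proof.
apply/forallP/eqP => [ab|-> i]; last by rewrite ffunE permK.
by apply/ffunP=> i; rewrite ffunE -(eqP (ab _)) permKV.
Qed.

Lemma msupp_permute D (pi : 'S_D.+1) (a : multiindex D) i :
  (pi i \in msupp (permute pi a)) = (i \in msupp a).
Proof. by rewrite !inE ffunE permK. Qed.

Lemma mdegree_permute D (pi : 'S_D.+1) (a : multiindex D) :
  mdegree (permute pi a) = mdegree a.
Proof.
rewrite /mdegree (reindex_inj (@perm_inj _ pi)).
by apply: eq_bigr => i _; rewrite ffunE permK.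
Qed.

Lemma card_eq1 (T : finType) (P : pred T) x :
  P =1 pred1 x -> #|[pred y | P y]| = 1%N.
Proof. by move=> Px; rewrite -(card1 x); apply: eq_card => y; apply: Px. Qed.

Section Index.
Variables (D r : nat).
Hypothesis r_gt0 : (0 < r)%N.
Implicit Types mu nu : Bindex D r.

Local Notation mult mu := (tmult (triplet_of mu)).
Local Notation vert mu := (tvert (triplet_of mu)).

Lemma BindexP mu : [/\ mdegree (mult mu) = r,
  tface (triplet_of mu) = msupp (mult mu) :|: [set vert mu]
  & ~~ lowest (msupp (mult mu)) (vert mu)].
Proof.
have := valP mu; rewrite -/(triplet_of mu).
by case: (triplet_of mu) => f k a; rewrite in_B_lowest //= => /and3P[/eqP ? /eqP].
Qed.

Lemma Bindex_supp_gt0 mu : (0 < #|msupp (mult mu)|)%N.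
Proof. by apply: card_msupp_gt0; case: (BindexP mu) => ->. Qed.

(** The face is recovered as the support together with the vertex. *)
Lemma Bindex_inj mu nu : mult mu = mult nu -> vert mu = vert nu -> mu = nu.
Proof.
move=> eqm eqv; have [_ fmu _] := BindexP mu; have [_ fnu _] := BindexP nu.
have eqf : tface (triplet_of mu) = tface (triplet_of nu) by rewrite fmu fnu eqm eqv.
apply: val_inj; move: eqm eqv eqf; rewrite /triplet_of /triplet_of_bounded.
case: (val mu) (val nu) => -[f k] a [[g l] b] /= /ffunP eqm -> ->.
congr (_, _); apply/ffunP => i; apply: val_inj.
by have := eqm i; rewrite !ffunE.
Qed.

Lemma leq_mdegree (a : multiindex D) i : (a i <= mdegree a)%N.
Proof. by rewrite /mdegree (bigD1 i) //= leq_addr. Qed.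

Lemma Bindex_ex (a : multiindex D) k : mdegree a = r -> ~~ lowest (msupp a) k ->
  exists mu, mult mu = a /\ vert mu = k.
Proof.
move=> ar low; pose t : bounded_triplet D r :=
  (msupp a :|: [set k], k, [ffun i => inord (a i)]).
have tE : triplet_of_bounded t = Triplet (msupp a :|: [set k]) k a.
  (* [inord] alters nothing, since a_i <= |a| = r. *)
  congr Triplet; apply/ffunP => i; rewrite !ffunE inordK // ltnS -ar.
  exact: leq_mdegree.
have tB : in_B r (triplet_of_bounded t) by rewrite tE in_B_lowest // ar !eqxx.
by exists (Sub t tB); rewrite /triplet_of SubK tE.
Qed.

Lemma sum_Bindex (V : nmodType) (a : multiindex D) (F : 'I_D.+1 -> V) :
  mdegree a = r ->
  \sum_(nu : Bindex D r | mult nu == a) F (vert nu) =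
  \sum_(l | ~~ lowest (msupp a) l) F l.
Proof.
move=> ar; rewrite (partition_big (fun nu : Bindex D r => vert nu)
  (fun l => ~~ lowest (msupp a) l)) => [|nu /eqP <-]; last by case: (BindexP nu).
apply: eq_bigr => l low; have [nu [nua nul]] := Bindex_ex ar low.
rewrite (big_pred1 nu) => [|nu']; first by rewrite nul.
apply/andP/eqP => [[/eqP nu'a /eqP nu'l]|->]; last by rewrite nua nul.
by apply: Bindex_inj; rewrite ?nu'a ?nu'l.
Qed.

(** Triplets sharing a multi-index are told apart by their vertex, and one of the D + 1 vertices is
    excluded. *)
Lemma card_Bindex_le (a : multiindex D) (P : pred (Bindex D r)) (m : 'I_D.+1) :
  (forall nu, P nu -> mult nu = a /\ vert nu != m) ->
  (#|[pred nu | P nu]| <= D)%N.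
Proof.
move=> Pa; have vert_inj : {in [pred nu | P nu] &, injective (fun nu : Bindex D r => vert nu)}.
  by move=> mu nu /Pa[mua _] /Pa[nua _]; apply: Bindex_inj; rewrite mua.
have cardm : #|predC1 m| = D by rewrite cardC1 card_ord.
rewrite -(card_in_imset vert_inj) -[leqRHS]cardm.
apply: subset_leq_card; apply/fintype.subsetP => k.
by move=> /imsetP[nu /Pa[_ nm] ->]; rewrite !inE.
Qed.

End Index.

(** * Linear independence of the forms *)

Section FormValues.
Variables (R : realFieldType) (D : nat).
Implicit Types (a : multiindex D) (k : 'I_D.+1) (X H : 'I_D.+1 -> R).
Implicit Types (t : triplet D) (pi : 'S_D.+1).

(* The value of the form b(.; a) psi(.; f, k, 1_a) at a point with barycentric
   coordinates X, on a vector on which the d xi_i take the values H i. *)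
Definition w_val t X H : R :=
  \prod_i X i ^+ tmult t i * psi_val (msupp (tmult t)) (tvert t) H.

(** These are the coefficients of [psi_val_expand]. The permuted support is read off [u], which has
    it whenever [carries] holds, so the degree never enters. *)
Definition rule pi t u : R :=
  if carries pi (tmult t) (tmult u) then
    if lowest (msupp (tmult u)) (pi (tvert t))
    then - (tvert u \in msupp (tmult u))%:R else (tvert u == pi (tvert t))%:R
  else 0.

Lemma rule_degree_blind : degree_blind rule.
Proof.
by move=> pi t u t' u' [_ vt _] [_ vu su] cE; rewrite /rule cE vt vu su.
Qed.

Section Degree.
Variable r : nat.
Hypothesis r_gt0 : (0 < r)%N.
Implicit Types mu nu : Bindex D r.

Local Notation mult mu := (tmult (triplet_of mu)).
Local Notation vert mu := (tvert (triplet_of mu)).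

Lemma w_val_rule pi mu X H :
  w_val (triplet_of mu) (X \o pi) (H \o pi) =
  \sum_(nu : Bindex D r) rule pi (triplet_of mu) (triplet_of nu) *
    w_val (triplet_of nu) X H.
Proof.
have [mur _ _] := BindexP r_gt0 mu.
set S := msupp (permute pi (mult mu)).
transitivity (\prod_i X i ^+ permute pi (mult mu) i * psi_val S (pi (vert mu)) H).
  congr (_ * _).
    rewrite [RHS](reindex_inj (@perm_inj _ pi)); apply: eq_bigr => i _.
    by rewrite [permute _ _ _]ffunE permK.
  rewrite /psi_val msupp_permute; congr (_ - _ / _ * _).
    rewrite -!sum1_card [in RHS](reindex_inj (@perm_inj _ pi)) !natr_sum.
    by apply: eq_bigl => i; rewrite msupp_permute.
  rewrite [RHS](reindex_inj (@perm_inj _ pi)).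
  by apply: eq_bigl => i; rewrite msupp_permute.
(* The possibly non-anchored form is expanded in anchored ones, and the sum over vertices becomes a
   sum over triplets with the permuted multi-index. *)
rewrite psi_val_expand -(sum_Bindex r_gt0); last by rewrite mdegree_permute.
rewrite mulr_sumr big_mkcond; apply: eq_bigr => nu _.
rewrite /rule carriesE; case: eqVneq => [eqm|]; last by rewrite mul0r.
by rewrite /w_val eqm -/S mulrCA.
Qed.

(** One tangent vector, dual to the vertex of [nu0], and one curve in the simplex suffice: exponents
    along the curve separate multi-indices, and duality separates vertices. *)
Lemma w_val_free (c : Bindex D r -> R) :
  (forall X H, (forall i, 0 <= X i) -> \sum_i X i = 1 -> \sum_i H i = 0 ->
     \sum_(nu : Bindex D r) c nu * w_val (triplet_of nu) X H = 0) ->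
  forall nu, c nu = 0.
Proof.
move=> c0 nu0.
pose H := dual_vec R (msupp (mult nu0)) (vert nu0).
have H0 : \sum_i H i = 0 by rewrite sum_dual_vec ?Bindex_supp_gt0.
pose psi (nu : Bindex D r) := psi_val (msupp (mult nu)) (vert nu) H.
pose N (nu : Bindex D r) := (\sum_i mult nu i * r.+1 ^ i)%N.
pose p := \sum_nu (c nu * psi nu) *: 'X^(N nu).
have p0 : p = 0.
  apply: poly_pos_eq0 => t t0; pose s := \sum_(i < D.+1) t ^+ (r.+1 ^ i).
  have ti (i : 'I_D.+1) : 0 < t ^+ (r.+1 ^ i) by rewrite exprn_gt0.
  have s0 : 0 < s.
    by rewrite /s (bigD1 ord0) //= ltr_pwDl // sumr_ge0 // => i _; rewrite ltW.
  have X1 : \sum_(i < D.+1) t ^+ (r.+1 ^ i) / s = 1.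
    by rewrite -mulr_suml divff ?gt_eqF.
  (* Dividing by s puts the point in the simplex; every monomial has degree r, so the factor s^r
     clears all denominators. *)
  have /(congr1 ( *%R (s ^+ r))) := c0 _ H (fun i => ltW (divr_gt0 (ti i) s0)) X1 H0.
  rewrite mulr0 => eq0.
  rewrite -[RHS]eq0 horner_sum mulr_sumr; apply: eq_bigr => nu _.
  rewrite hornerZ hornerXn /w_val -/(psi nu).
  rewrite [in RHS](eq_bigr (fun i : 'I_D.+1 =>
    t ^+ (mult nu i * r.+1 ^ i) * s^-1 ^+ mult nu i)); last first.
    by move=> i _; rewrite exprMn -exprM mulnC.
  rewrite big_split /= -!expr_sum -/(N nu).
  have -> : (\sum_i mult nu i = r)%N by case: (BindexP r_gt0 nu).
  rewrite exprVn [c nu * (_ * _)]mulrCA [RHS]mulrA [s ^+ r * _]mulrC divfK.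
    by rewrite mulrC.
  by rewrite expf_neq0 ?gt_eqF.
(* In the coefficient at [N nu0] only triplets with the multi-index of [nu0] survive, because all
   digits are at most r; H is dual for their common support. *)
have := congr1 (fun q : {poly R} => q`_(N nu0)) p0.
rewrite coef0 coef_sum (bigD1 nu0) //= coefZ coefXn eqxx mulr1 big1 => [|nu nu_neq].
  have [_ _ low] := BindexP r_gt0 nu0.
  by rewrite addr0 /psi psi_dual_vec ?Bindex_supp_gt0 // eqxx mulr1.
rewrite coefZ coefXn; have [eqN|] := eqVneq (N nu0) (N nu); last by rewrite mulr0.
have bound (mu : Bindex D r) i : (mult mu i < r.+1)%N.
  have [mur _ _] := BindexP r_gt0 mu.
  by rewrite ltnS; apply: leq_trans (leq_mdegree _ i) _; rewrite mur.
have eqm : mult nu = mult nu0.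
  by apply/ffunP; apply: (kronecker_inj (bound nu) (bound nu0)); rewrite -/(N nu) -eqN.
have [_ _ low] := BindexP r_gt0 nu.
rewrite /psi /H -eqm psi_dual_vec ?Bindex_supp_gt0 //.
case: eqVneq => [eqv|]; last by rewrite mulr0 mul0r.
by case/eqP: nu_neq; apply: (Bindex_inj r_gt0).
Qed.

End Degree.
End FormValues.

(** * Affine maps and barycentric coordinates *)

Section Affine.
Variables (R : realType) (D : nat).

(** Expanding on the standard basis gives a finite sum of continuous coordinate maps; this
    continuity is what [diff_lin] needs. *)
Lemma row_linear_continuous (V : normedModType R) (L : {linear 'rV[R]_D -> V}) :
  continuous L.
Proof.
have -> : (L : _ -> _) = fun x => \sum_j x ord0 j *: L (delta_mx ord0 j).
  apply/funext => x; rewrite {1}(row_sum_delta x) linear_sum.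
  by apply: eq_bigr => j _; rewrite linearZ.
apply: continuous_big => [|j _ x]; first exact: add_continuous.
by apply: continuousZr_tmp; exact: coord_continuous.
Qed.

Lemma diff_affine (V : normedModType R) (F : 'rV[R]_D -> V)
  (L : {linear 'rV[R]_D -> V}) c x h : (forall y, F y = L y + c) -> 'd F x h = L h.
Proof.
move=> FE; have -> : F = (L : _ -> _) + cst c by apply/funext => y; rewrite FE.
have Lc := @row_linear_continuous V L.
rewrite diffD ?diff_cst //=; last exact: linear_differentiable.
by rewrite diff_lin // addr0.
Qed.

Lemma affine_map_comb (V : normedModType R) (F : 'rV[R]_D -> V) (I : finType)
    (v : I -> 'rV[R]_D) (X : I -> R) : affine_map F -> \sum_i X i = 1 ->
  F (\sum_i X i *: v i) = \sum_i X i *: F (v i).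
Proof.
case=> L [c FE] X1; rewrite FE linear_sum -[c]scale1r -X1 scaler_suml -big_split.
by apply: eq_bigr => i _; rewrite FE scalerDr linearZ.
Qed.

(** Weights of sum zero kill the constant part, so the linear part can be read from the values of
    F. *)
Lemma diff_affine_map_comb (V : normedModType R) (F : 'rV[R]_D -> V) (I : finType)
    (v : I -> 'rV[R]_D) (H : I -> R) x : affine_map F -> \sum_i H i = 0 ->
  'd F x (\sum_i H i *: v i) = \sum_i H i *: F (v i).
Proof.
case=> L [c FE] H0; rewrite (diff_affine _ _ FE) linear_sum.
rewrite [RHS](eq_bigr (fun i => H i *: L (v i) + H i *: c)) => [|i _]; last first.
  by rewrite FE scalerDr.
rewrite big_split /= -scaler_suml H0 scale0r addr0.
by apply: eq_bigr => i _; rewrite linearZ.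
Qed.

End Affine.

(** * Evaluation of forms and pullbacks on the simplex *)

Section Simplex.
Variables (R : realType) (D : nat) (v : 'I_D.+1 -> 'rV[R]_D).

Lemma tangent_comb (h : 'rV[R]_D) : nondegenerate_simplex v ->
  exists2 H : 'I_D.+1 -> R, \sum_i H i = 0 & h = \sum_i H i *: v i.
Proof.
rewrite /nondegenerate_simplex; set M := \matrix_i _; rewrite row_free_unit => Mu.
pose u := h *m invmx M.
(* The entries of u are coordinates in the basis of edges v_j - v_0; v_0 receives minus their
   sum. *)
exists (fun i => if unlift ord0 i is Some j then u ord0 j else - \sum_j u ord0 j).
  rewrite big_ord_recl unlift_none addrC; apply/eqP; rewrite subr_eq0; apply/eqP.
  by apply: eq_bigr => j _; rewrite liftK.
rewrite big_ord_recl unlift_none -[LHS](mulmxKV Mu) -/u mulmx_sum_row.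
rewrite addrC scaleNr scaler_suml -sumrB; apply: eq_bigr => j _.
by rewrite liftK rowK scalerBr.
Qed.

Variable xi : 'I_D.+1 -> 'rV[R]_D -> R.
Hypothesis hxi : barycentric v xi.

Lemma barycentric_comb i (X : 'I_D.+1 -> R) : \sum_j X j = 1 ->
  xi i (\sum_j X j *: v j) = X i.
Proof.
case: hxi => aff xiv X1; rewrite (affine_map_comb _ (aff i) X1).
rewrite (bigD1 i) //= xiv eqxx big1 => [|j /negbTE ji].
  by rewrite addr0; apply: mulr1.
by rewrite xiv eq_sym ji scaler0.
Qed.

Lemma diff_barycentric_comb i x (H : 'I_D.+1 -> R) : \sum_j H j = 0 ->
  'd (xi i) x (\sum_j H j *: v j) = H i.
Proof.
case: hxi => aff xiv H0.
rewrite (diff_affine_map_comb _ _ (aff i) H0).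
rewrite (bigD1 i) //= xiv eqxx big1 => [|j /negbTE ji].
  by rewrite addr0; apply: mulr1.
by rewrite xiv eq_sym ji scaler0.
Qed.

Variable r : nat.
Hypothesis r_gt0 : (0 < r)%N.

Lemma wform_w_val (mu : Bindex D r) x h :
  wform xi (triplet_of mu) x h =
  w_val (triplet_of mu) (xi^~ x) (fun i => 'd (xi i) x h).
Proof.
have [_ fE _] := BindexP r_gt0 mu; rewrite /wform /w_val /psi /psi_val.
congr (_ * (_ - _)); rewrite mdegree_mind fE.
rewrite [mind _ _]ffunE -/(tmult _) [_ \in msupp _]inE.
have [k0|kS] := posnP (tmult (triplet_of mu) (tvert (triplet_of mu))).
  by rewrite !mul0r.
congr (_ * _); apply: eq_bigl => j.
by rewrite !inE; case: eqVneq => [->|_]; rewrite ?orbF ?kS.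
Qed.

Lemma wform_comb (mu : Bindex D r) (X H : 'I_D.+1 -> R) :
  \sum_i X i = 1 -> \sum_i H i = 0 ->
  wform xi (triplet_of mu) (\sum_i X i *: v i) (\sum_i H i *: v i) =
  w_val (triplet_of mu) X H.
Proof.
move=> X1 H0; rewrite wform_w_val; congr w_val; apply/funext => i.
  exact: barycentric_comb.
exact: diff_barycentric_comb.
Qed.

Variables (pi : 'S_D.+1) (A : 'rV[R]_D -> 'rV[R]_D).
Hypothesis hA : vertex_map v (pi^-1)%g A.

Lemma sum_perm (V : nmodType) (F : 'I_D.+1 -> V) : \sum_i F (pi i) = \sum_i F i.
Proof. by rewrite [RHS](reindex_inj (@perm_inj _ pi)). Qed.

(** A sends v_i to v_(pi^-1 i), hence the point with coordinates X to the one with coordinates X o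
    pi. *)
Lemma pullback_comb (mu : Bindex D r) (X H : 'I_D.+1 -> R) :
  \sum_i X i = 1 -> \sum_i H i = 0 ->
  pullback A (wform xi (triplet_of mu)) (\sum_i X i *: v i) (\sum_i H i *: v i) =
  w_val (triplet_of mu) (X \o pi) (H \o pi).
Proof.
move=> X1 H0; have [aff Av] := hA.
have Acomb (Y : 'I_D.+1 -> R) :
    \sum_i Y i *: A (v i) = \sum_i (Y \o pi) i *: v i.
  rewrite -[LHS]sum_perm.
  by apply: eq_bigr => i _; rewrite Av permK.
rewrite /pullback (affine_map_comb _ aff X1) (diff_affine_map_comb _ _ aff H0).
by rewrite !Acomb wform_comb // sum_perm.
Qed.

(** Points and tangent vectors are traded for their coordinates; nondegeneracy ensures that every
    tangent vector is reached. *)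
Lemma transition_w_val (T : 'M[R]_#|Bindex D r|) :
  nondegenerate_simplex v ->
  transition xi v A T <->
  (forall (mu : Bindex D r) (X H : 'I_D.+1 -> R),
     (forall i, 0 <= X i) -> \sum_i X i = 1 -> \sum_i H i = 0 ->
     w_val (triplet_of mu) (X \o pi) (H \o pi) =
     \sum_(nu : Bindex D r) entry T mu nu * w_val (triplet_of nu) X H).
Proof.
move=> hv; split=> [tr mu X H X0 X1 H0 | tr mu x h [X [X0 X1 ->]]].
  rewrite -pullback_comb // tr; last by exists X.
  by apply: eq_bigr => nu _; rewrite wform_comb.
have [H H0 ->] := tangent_comb h hv.
rewrite pullback_comb // tr //.
by apply: eq_bigr => nu _; rewrite wform_comb.
Qed.

Definition rule_mx : 'M[R]_#|Bindex D r| :=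
  \matrix_(i, j) rule R pi (triplet_of (enum_val i)) (triplet_of (enum_val j)).

Lemma entry_rule_mx (mu nu : Bindex D r) :
  entry rule_mx mu nu = rule R pi (triplet_of mu) (triplet_of nu).
Proof. by rewrite /entry mxE !enum_rankK. Qed.

Lemma transition_rule_mx (T : 'M[R]_#|Bindex D r|) :
  nondegenerate_simplex v -> transition xi v A T <-> T = rule_mx.
Proof.
move=> hv; rewrite transition_w_val //; split=> [tr|-> mu X H _ _ _]; last first.
  by rewrite w_val_rule //; apply: eq_bigr => nu _; rewrite entry_rule_mx.
apply/matrixP => i j; rewrite -(enum_valK i) -(enum_valK j) -!/(entry _ _ _).
(* With the row fixed, the difference of two candidate rows is a linear relation between the forms,
   to which [w_val_free] applies. *)
apply/eqP; rewrite -subr_eq0; apply/eqP; move: (enum_val i) (enum_val j) => mu.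
apply: (w_val_free r_gt0) => X H X0 X1 H0; under eq_bigr do rewrite mulrBl.
rewrite sumrB -tr // w_val_rule //.
apply/eqP; rewrite subr_eq0; apply/eqP.
by apply: eq_bigr => nu _; rewrite entry_rule_mx.
Qed.

End Simplex.

(** * The transition matrix *)

Section RuleMatrix.
Variables (R : realType) (D r : nat).
Hypothesis r_gt0 : (0 < r)%N.
Implicit Types (pi : 'S_D.+1) (mu nu : Bindex D r).

Lemma rule_values pi t u : rule R pi t u \in [:: -1; 0; 1].
Proof.
rewrite /rule; case: ifP => _; last by rewrite !inE eqxx orbT.
by case: ifP => _; [case: (tvert u \in _) | case: (tvert u == _)];
  rewrite ?oppr0 !inE eqxx ?orbT.
Qed.

Lemma rule_row pi mu (t := triplet_of mu) :
  (#|[pred nu : Bindex D r | rule R pi t (triplet_of nu) != 0]| = 1%N /\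
   forall nu, rule R pi t (triplet_of nu) != 0 -> rule R pi t (triplet_of nu) = 1) \/
  ((#|[pred nu : Bindex D r | rule R pi t (triplet_of nu) != 0%R]| <= D)%N /\
   forall nu, rule R pi t (triplet_of nu) != 0 -> rule R pi t (triplet_of nu) = -1).
Proof.
set a := permute pi (tmult t).
set k := pi (tvert t).
have ruleE (nu : Bindex D r) : rule R pi t (triplet_of nu) =
    if tmult (triplet_of nu) == a then
      if lowest (msupp a) k then - (tvert (triplet_of nu) \in msupp a)%:R
      else (tvert (triplet_of nu) == k)%:R
    else 0.
  by rewrite /rule carriesE -/a; case: eqP => // ->.
have [lowk|lowk] := boolP (lowest (msupp a) k); [right|left].
  have neqk (nu : Bindex D r) : rule R pi t (triplet_of nu) != 0 ->
      tmult (triplet_of nu) = a /\ tvert (triplet_of nu) != k.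
    rewrite ruleE; case: (eqVneq _ a) => [eqa _|_]; last by rewrite eqxx.
    (* A vertex of the index set is never lowest in its support, whereas k is: this excludes k and
       leaves at most D vertices. *)
    split=> //; have [_ _] := BindexP r_gt0 nu.
    by rewrite eqa; apply: contraNneq => ->.
  split=> [|nu]; first exact: (card_Bindex_le r_gt0 neqk).
  rewrite ruleE lowk; case: ifP => _; last by rewrite eqxx.
  by case: (_ \in _); rewrite ?oppr0 ?eqxx.
have [|nu0 [nu0a nu0k]] := Bindex_ex r_gt0 (a := a) _ lowk.
  by rewrite mdegree_permute; case: (BindexP r_gt0 mu).
have eqnu0 (nu : Bindex D r) : (rule R pi t (triplet_of nu) != 0) = (nu == nu0).
  rewrite ruleE (negbTE lowk).
  apply/idP/eqP => [|->]; last by rewrite nu0a nu0k !eqxx oner_eq0.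
  case: (eqVneq _ a) => [nua|_]; last by rewrite eqxx.
  case: (eqVneq _ k) => [nuk _|_]; last by rewrite eqxx.
  by apply: (Bindex_inj r_gt0); rewrite ?nua ?nuk.
split=> [|nu]; first exact: card_eq1 eqnu0.
rewrite ruleE (negbTE lowk); case: ifP => _; last by rewrite eqxx.
by case: (_ == k); rewrite ?eqxx.
Qed.

(** Substituting along pi^-1 and then pi restores each form, and freeness turns this into a matrix
    identity. *)
Lemma mul_rule_mxV pi : rule_mx R r pi *m rule_mx R r (pi^-1)%g = 1%:M.
Proof.
apply/matrixP => i j; rewrite -(enum_valK i) -(enum_valK j).
move: (enum_val i) (enum_val j) => mu nu {i j}.
apply/eqP; rewrite -subr_eq0; apply/eqP; move: nu.
apply: (w_val_free r_gt0) => X H _ _ _; under eq_bigr do rewrite mulrBl.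
rewrite sumrB; apply/eqP; rewrite subr_eq0; apply/eqP.
transitivity (w_val (triplet_of mu) X H).
  (* Expanding these intermediate forms along pi^-1 yields the product matrix; collecting them along
     pi yields the original form. *)
  transitivity (\sum_(rho : Bindex D r) rule R pi (triplet_of mu) (triplet_of rho) *
      w_val (triplet_of rho) (X \o (pi^-1)%g) (H \o (pi^-1)%g)).
    under [RHS]eq_bigr do rewrite w_val_rule // mulr_sumr.
    rewrite exchange_big; apply: eq_bigr => nu _ /=.
    rewrite mxE mulr_suml (reindex _ (onW_bij _ (@enum_rank_bij _))) /=.
    by apply: eq_bigr => rho _; rewrite !mxE !enum_rankK mulrA.
  by rewrite -w_val_rule //; congr w_val; apply/funext => i /=; rewrite permK.
rewrite (bigD1 mu) //= mxE eqxx mul1r big1 ?addr0 // => nu nu_mu.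
by rewrite mxE (inj_eq (@enum_rank_inj _)) eq_sym (negbTE nu_mu) mul0r.
Qed.

End RuleMatrix.

Theorem corollary4 (R : realType) (D : nat) (hD : (1 <= D)%N)
    (v : 'I_D.+1 -> 'rV[R]_D) (hv : nondegenerate_simplex v)
    (xi : 'I_D.+1 -> 'rV[R]_D -> R) (hxi : barycentric v xi)
    (A : 'S_D.+1 -> 'rV[R]_D -> 'rV[R]_D)
    (hA : forall pi : 'S_D.+1, vertex_map v pi (A pi)) :
  [/\ (* T(pi) is well defined *)
      forall (r : nat) (pi : 'S_D.+1), (1 <= r)%N ->
        exists! T : 'M[R]_#|Bindex D r|, transition xi v (A (pi^-1)%g) T,

      forall (r : nat) (T : 'S_D.+1 -> 'M[R]_#|Bindex D r|), (1 <= r)%N ->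
        (forall pi : 'S_D.+1, transition xi v (A (pi^-1)%g) (T pi)) ->
        forall pi : 'S_D.+1,
        [/\ forall mu nu : Bindex D r,
              entry (T pi) mu nu \in [:: -1; 0; 1],
            forall mu : Bindex D r,
              (#|[pred nu | entry (T pi) mu nu != 0]| = 1%N /\
               forall nu, entry (T pi) mu nu != 0 -> entry (T pi) mu nu = 1)
              \/
              ((#|[pred nu | entry (T pi) mu nu != 0%R]| <= D)%N /\
               forall nu, entry (T pi) mu nu != 0 -> entry (T pi) mu nu = -1),
            T pi \in unitmx
          & invmx (T pi) = T (pi^-1)%g]

    & (* T(pi) depends on r only through its index set *)
      exists rule : 'S_D.+1 -> triplet D -> triplet D -> R,
        degree_blind rule /\
        forall (r : nat) (pi : 'S_D.+1) (T : 'M[R]_#|Bindex D r|), (1 <= r)%N ->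
          transition xi v (A (pi^-1)%g) T ->
          forall mu nu : Bindex D r,
            entry T mu nu = rule pi (triplet_of mu) (triplet_of nu)].
Proof.
have transP r pi (T : 'M[R]_#|Bindex D r|) : (1 <= r)%N ->
    transition xi v (A (pi^-1)%g) T <-> T = rule_mx R r pi.
  by move=> r_gt0; apply: transition_rule_mx.
split=> [r pi r_gt0|r T r_gt0 trT pi|].
- exists (rule_mx R r pi); split; first exact/transP.
  by move=> T /(transP _ _ _ r_gt0).
- have TE rho : T rho = rule_mx R r rho by apply/transP.
  have TV := mul_rule_mxV R r_gt0 pi.
  (* For square matrices a one-sided inverse gives invertibility. *)
  have [Tu _] := mulmx1_unit TV.
  split=> [mu nu|mu||]; rewrite !TE //.
  + by rewrite entry_rule_mx; apply: rule_values.
  + have predE : [pred nu | entry (rule_mx R r pi) mu nu != 0] =i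
        [pred nu | rule R pi (triplet_of mu) (triplet_of nu) != 0].
      by move=> nu; rewrite !inE entry_rule_mx.
    rewrite (eq_card predE); have [[c P]|[c P]] := rule_row R r_gt0 pi mu; [left|right].
      by split=> // nu; rewrite entry_rule_mx; apply: P.
    by split=> // nu; rewrite entry_rule_mx; apply: P.
  + by rewrite -[RHS](mulKmx Tu) TV mulmx1.
- exists (@rule R D); split; first exact: rule_degree_blind.
  by move=> r pi T r_gt0 /(transP _ _ _ r_gt0) -> mu nu; rewrite entry_rule_mx.
Qed.
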